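(* Let $n\ge2$ and $k_1,\dots,k_n\ge1$ be integers. There exists a term order on $\mathbb{C}[z_I: I\in\prod_{j=1}^n\{0,\dots,k_j\},\ |I|\ge2]$ with respect to which the basis binomials $z_Az_B-z_Cz_D$ (defined in the context) form a Gröbner basis of the toric ideal of the polytope $P$. Moreover, with respect to this term order the leading monomial of each basis binomial $z_Az_B-z_Cz_D$ is $z_Az_B$ (where $(C,D)$ is the sorted pair). In particular, the Gröbner basis is quadratic and the leading monomials are square-free.
   Context: For $I=(i_1,\dots,i_n)\in\prod_j\{0,\dots,k_j\}$ let $|I|=\#\{j:i_j\neq0\}$. Consider the lattice $M=\mathbb{Z}^{k_1+1}\times\dots\times\mathbb{Z}^{k_n+1}$, with $e^j_0,\dots,e^j_{k_j}$ the standard basis of the $j$-th factor. To each $I$ with $|I|\ge2$ associate the point $p_I=e^1_{i_1}\oplus\dots\oplus e^n_{i_n}\in M$; $P$ is the convex hull of these points. The toric ideal of $P$ is the kernel of the homomorphism $\mathbb{C}[z_I:|I|\ge2]\to\mathbb{C}[M]$, $z_I\mapsto\chi^{p_I}$ (the monomial with exponent $p_I$). To each $I=(i_1,\dots,i_n)$ associate the set of pairs $A_I=\{(j,i_j): i_j\ne0\}$. Pairs are ordered by $(1,1)<\dots<(1,k_1)<(2,1)<\dots<(n,k_n)<(\infty,\infty)$. Let $\bar A_I$ be the multiset with exactly $n$ elements obtained from $A_I$ by adding $(\infty,\infty)$ with multiplicity $n-|I|$. The multiset $\bar A_I$ is called admissible if $|I|\ge2$. The variables $z_I$ ($|I|\ge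 2$) are thus indexed equivalently by admissible multisets. A pair $(C,D)$ of admissible multisets, $C=\{c_1\le\dots\le c_n\}$, $D=\{d_1\le\dots\le d_n\}$, is sorted if $c_1\le d_1\le c_2\le d_2\le\dots\le c_n\le d_n$. For any admissible $A,B$ there is a unique sorted pair $(C,D)$ of admissible multisets with $A\cup B=C\cup D$ as multisets (unions counted with multiplicity): sort $A\cup B$, let $C$ consist of the elements in odd positions and $D$ of those in even positions. A basis binomial is a binomial $z_Az_B-z_Cz_D$, where $A,B$ are admissible multisets such that neither $(A,B)$ nor $(B,A)$ is sorted, and $(C,D)$ is the sorted pair with $A\cup B=C\cup D$. *)

(* Defs.v *)
From HB Require Import structures.
From mathcomp Require Import all_boot all_order all_algebra.
From mathcomp Require Import reals complex.
From mathcomp Require Import finmap.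
From mathcomp Require monalg.

Set Implicit Arguments.
Unset Strict Implicit.
Unset Printing Implicit Defensive.

Import GRing.Theory.
Local Open Scope ring_scope.

(* [monalg] and [mpoly] declare clashing notations, so that [monalg] is only
   imported inside this module. *)
Module GroupAlgebra.
Import monalg.

(* The group algebra R[M] of an additive group M.  Its elements are finitely
   supported functions M -> R.  The product of [monalg] is only available for
   monoids without nontrivial units, whence the convolution product below. *)
Definition grpalg (R : comNzRingType) (M : zmodType) : Type := {malg R[M]}.

Section Theory.
Context (R : comNzRingType) (M : zmodType).

HB.instance Definition _ := GRing.Lmodule.on (grpalg R M).

Implicit Types (g : {malg R[M]}).

Definition gmul g1 g2 : {malg R[M]} :=
  \sum_(a <- msupp g1) \sum_(b <- msupp g2)
     << g1@_a * g2@_b *g a + b >>.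

Lemma gmulEw (d1 d2 : {fset M}) g1 g2 :
  (msupp g1 `<=` d1)%fset -> (msupp g2 `<=` d2)%fset ->
  gmul g1 g2 = \sum_(a <- d1) \sum_(b <- d2) << g1@_a * g2@_b *g a + b >>.
Proof.
move=> le_d1 le_d2; rewrite /gmul (big_fset_incl _ le_d1) /=.
  apply/eq_bigr=> a _; apply/big_fset_incl => // b _ /mcoeff_outdom ->.
  by rewrite mulr0 monalgU0.
move=> a _ /mcoeff_outdom g1a.
by rewrite big1 // => b _; rewrite g1a mul0r monalgU0.
Qed.

Lemma gmulUU c1 c2 (a b : M) :
  gmul << c1 *g a >> << c2 *g b >> = << c1 * c2 *g a + b >>.
Proof. by rewrite (gmulEw msuppU_le msuppU_le) !big_seq_fset1 !mcoeffUU. Qed.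

Lemma gmulC : commutative gmul.
Proof.
move=> g1 g2; rewrite /gmul exchange_big /=.
by apply/eq_bigr=> b _; apply/eq_bigr=> a _; rewrite mulrC addrC.
Qed.

Lemma gmulDl : left_distributive gmul +%R.
Proof.
move=> g1 g2 g.
rewrite (gmulEw (msuppD_le g1 g2) (fsubset_refl _)).
rewrite (gmulEw (fsubsetUl _ (msupp g2)) (fsubset_refl (msupp g))).
rewrite (gmulEw (fsubsetUr (msupp g1) _) (fsubset_refl (msupp g))).
rewrite -big_split /=; apply/eq_bigr=> a _.
rewrite -big_split /=; apply/eq_bigr=> b _.
by rewrite mcoeffD mulrDl monalgUD.
Qed.

Lemma gmulDr : right_distributive gmul +%R.
Proof. by move=> g g1 g2; rewrite !(gmulC g) gmulDl. Qed.

Lemma gmul0g : left_zero 0 gmul.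
Proof. by move=> g; rewrite /gmul msupp0 big_seq_fset0. Qed.

Lemma gmulg0 : right_zero 0 gmul.
Proof. by move=> g; rewrite gmulC gmul0g. Qed.

Lemma gmul1g : left_id << 1 *g 0 >> gmul.
Proof.
move=> g; rewrite (gmulEw msuppU_le (fsubset_refl _)) big_seq_fset1.
rewrite [RHS]monalgE; apply/eq_bigr=> b _.
by rewrite mcoeffUU mul1r add0r.
Qed.

Lemma gmul_suml (I : Type) (r : seq I) (F : I -> {malg R[M]}) g :
  gmul (\sum_(i <- r) F i) g = \sum_(i <- r) gmul (F i) g.
Proof. exact: (big_morph (gmul^~ g) (fun _ _ => gmulDl _ _ _) (gmul0g _)). Qed.

Lemma gmul_sumr (I : Type) (r : seq I) (F : I -> {malg R[M]}) g :
  gmul g (\sum_(i <- r) F i) = \sum_(i <- r) gmul g (F i).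
Proof. exact: (big_morph (gmul g) (fun _ _ => gmulDr _ _ _) (gmulg0 _)). Qed.

Lemma gmulA : associative gmul.
Proof.
move=> g1 g2 g3.
rewrite (monalgE g1) !gmul_suml; apply/eq_bigr=> a _.
rewrite (monalgE g2) gmul_suml !gmul_sumr gmul_suml; apply/eq_bigr=> b _.
rewrite (monalgE g3) !gmul_sumr; apply/eq_bigr=> c _.
by rewrite !gmulUU mulrA addrA.
Qed.

Lemma gone_neq0 : (<< 1 *g 0 >> : {malg R[M]}) != 0.
Proof. by rewrite monalgU_eq0 oner_eq0. Qed.

HB.instance Definition _ := GRing.Zmodule_isComNzRing.Build (grpalg R M)
  gmulA gmulC gmul1g gmulDl gone_neq0.

Lemma gscaleAl (c : R) (g1 g2 : grpalg R M) :
  c *: (g1 * g2) = (c *: g1) * g2.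
Proof.
have scaleU x (a : M) : c *: (<< x *g a >> : {malg R[M]}) = << c * x *g a >>.
  by apply/malgP=> b; rewrite mcoeffZ !mcoeffU mulrnAr.
change (c *: gmul g1 g2 = gmul (c *: (g1 : {malg R[M]})) g2).
rewrite (monalgE g1) gmul_suml !scaler_sumr gmul_suml.
apply/eq_bigr=> a _; rewrite scaleU (monalgE g2) !gmul_sumr scaler_sumr.
by apply/eq_bigr=> b _; rewrite !gmulUU scaleU mulrA.
Qed.

HB.instance Definition _ :=
  GRing.Lmodule_isLalgebra.Build R (grpalg R M) gscaleAl.
HB.instance Definition _ := GRing.Lalgebra_isComAlgebra.Build R (grpalg R M).

Definition chi (m : M) : grpalg R M := << 1 *g m >>.

Lemma chi0 : chi 0 = 1.
Proof. by []. Qed.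

Lemma chiD (a b : M) : chi (a + b) = chi a * chi b.
Proof. by rewrite [RHS]gmulUU mulr1. Qed.

End Theory.

End GroupAlgebra.
Export GroupAlgebra.

From mathcomp Require Import mpoly.

Section Groebner.
Context (F : fieldType) (N : nat).

Definition ideal_generated (S : {mpoly F[N]} -> Prop) (f : {mpoly F[N]}) :=
  exists2 s : seq ({mpoly F[N]} * {mpoly F[N]}),
    forall q, q \in s -> S q.2 & f = \sum_(q <- s) q.1 * q.2.

Record term_order (le : rel 'X_{1..N}) : Prop := TermOrder {
  term_order_total : total le;
  term_order_trans : transitive le;
  term_order_anti : antisymmetric le;
  term_order_min : forall m, le 0%MM m;
  term_order_add : forall m m1 m2, le m1 m2 -> le (m + m1)%MM (m + m2)%MM
}.

Definition leading_monomial (le : rel 'X_{1..N}) (f : {mpoly F[N]}) m :=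
  m \in msupp f /\ forall m', m' \in msupp f -> le m' m.

Definition initial_monomials le (S : {mpoly F[N]} -> Prop) (t : {mpoly F[N]}) :=
  exists f m, [/\ S f, leading_monomial le f m & t = 'X_[m]].

Definition initial_ideal le S := ideal_generated (initial_monomials le S).

Definition groebner_basis le (I : {mpoly F[N]} -> Prop)
    (G : seq {mpoly F[N]}) :=
  (forall g, g \in G -> I g) /\
  (forall f, initial_ideal le I f <-> initial_ideal le (fun g => g \in G) f).

Definition squarefree_monomial (m : 'X_{1..N}) := forall i, (m i <= 1)%N.

End Groebner.

Section SortedPairs.
Context (n : nat) (k : 'I_n -> nat).

Definition multi_index := {dffun forall j : 'I_n, 'I_(k j).+1}.
HB.instance Definition _ := Finite.on multi_index.

Definition index_weight (I : multi_index) : nat := #|[set j | I j != ord0]|.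

Definition admissible_index := {I : multi_index | (2 <= index_weight I)%N}.
HB.instance Definition _ := Finite.on admissible_index.

(* [None] stands for (oo, oo). *)
Definition pair_le (x y : option ('I_n * nat)) : bool :=
  match x, y with
  | _, None => true
  | None, Some _ => false
  | Some (j, i), Some (j', i') => (j < j')%N || (j == j') && (i <= i')%N
  end.

(* Multisets are sequences up to [perm_eq]. *)
Definition Abar (I : multi_index) : seq (option ('I_n * nat)) :=
  [seq Some (j, nat_of_ord (I j)) | j <- enum 'I_n & I j != ord0]
    ++ nseq (n - index_weight I) None.

Definition interleave (T : Type) (c d : seq T) : seq T :=
  flatten [seq [:: q.1; q.2] | q <- zip c d].

Definition sorted_pair (C D : admissible_index) : bool :=
  sorted pair_le
    (interleave (sort pair_le (Abar (val C))) (sort pair_le (Abar (val D)))).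

Definition same_union (A B C D : admissible_index) : bool :=
  perm_eq (Abar (val A) ++ Abar (val B)) (Abar (val C) ++ Abar (val D)).

Definition basis_quadruple (A B C D : admissible_index) : bool :=
  [&& ~~ sorted_pair A B, ~~ sorted_pair B A, sorted_pair C D
    & same_union A B C D].

(* The lattice Z^(k_1+1) x ... x Z^(k_n+1), as functions on the disjoint union
   of the coordinate sets. *)
Definition lattice := {ffun {j : 'I_n & 'I_(k j).+1} -> int}.
HB.instance Definition _ := GRing.Zmodule.on lattice.

Definition basis_vector (j : 'I_n) (i : 'I_(k j).+1) : lattice :=
  [ffun t => (t == Tagged (fun j => 'I_(k j).+1) i)%:R].

Definition index_point (I : multi_index) : lattice :=
  \sum_(j < n) basis_vector (I j).

Definition nvars : nat := #|{: admissible_index}|.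

Definition zmon (A : admissible_index) : 'X_{1..nvars} :=
  U_(enum_rank A)%MM.

Context (F : fieldType).

Definition zvar (A : admissible_index) : {mpoly F[nvars]} :=
  'X_(enum_rank A).

Definition toric_map (f : {mpoly F[nvars]}) : grpalg F lattice :=
  mmap (in_alg (grpalg F lattice))
    (fun v : 'I_nvars => chi F (index_point (val (enum_val v)))) f.

Lemma toric_map_zvar A : toric_map (zvar A) = chi F (index_point (val A)).
Proof. by rewrite /toric_map mmapX mmap1U enum_rankK. Qed.

Definition toric_ideal (f : {mpoly F[nvars]}) : Prop := toric_map f = 0.

Definition sorting_binomial (A B C D : admissible_index) : {mpoly F[nvars]} :=
  zvar A * zvar B - zvar C * zvar D.

Definition basis_binomials : seq {mpoly F[nvars]} :=
  [seq sorting_binomial q.1.1 q.1.2 q.2.1 q.2.2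
  | q <- enum {: (admissible_index * admissible_index)
                 * (admissible_index * admissible_index)}
  & basis_quadruple q.1.1 q.1.2 q.2.1 q.2.2].

End SortedPairs.

Arguments zvar {n k} F A.
Arguments sorting_binomial {n k} F A B C D.
Arguments toric_map {n} k F f.
Arguments toric_ideal {n} k F f.
Arguments basis_binomials {n} k F.

(* Main.v *)
(** Encode an admissible multiset A by its cumulative counts x_A(t), the number
    of elements of A that are at most t.  A pair (C, D) is sorted exactly when
    x_C - x_D takes its values in {0, 1}, and sorting (A, B) balances the sums
    x_A + x_B.  Hence the weight of A, the sum over all thresholds s, t of
    (x_A(s) - x_A(t))^2, strictly decreases in total when an unsorted pair is
    sorted, by convexity; comparing weights first, with ties broken by an
    arbitrary term order, gives the required term order.

    In a monomial all of whose pairs are sorted, the multisets form a chain and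
    the largest one is the rounded-up average of the x_A, so that it is
    determined by the degree and the sum of the x_A, both of which can be read
    off the image of the monomial under the toric map.  By induction on the
    degree there is at most one such monomial in each fibre, and it is the
    smallest element of its fibre.  The leading monomial of an element f of the
    toric ideal is not the smallest of its fibre, because another monomial of f
    must cancel its image; so it is divisible by some unsorted z_A z_B. *)
From HB Require Import structures.
Require Import Defs.
From mathcomp Require Import all_boot all_order all_algebra.
From mathcomp Require Import reals complex.
From mathcomp Require Import zify.
From mathcomp Require monalg.

Set Implicit Arguments.
Unset Strict Implicit.
Unset Printing Implicit Defensive.

(** * Sorted interleavings *)

Section Interleave.
Context (T : eqType).
Implicit Types (x y : T) (c d : seq T) (P : pred T) (le : rel T).

Lemma interleave_cons x c y d :
  interleave (x :: c) (y :: d) = [:: x, y & interleave c d].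
Proof. by []. Qed.

Lemma count_interleave P c d :
  size c = size d -> count P (interleave c d) = count P c + count P d.
Proof.
elim: c d => [|x c IH] [|y d] // [szE].
by rewrite interleave_cons /= IH //; lia.
Qed.

Lemma sorted_interleave_count le P c d :
    transitive le -> (forall x y, le x y -> P y -> P x) -> size c = size d ->
  sorted le (interleave c d) -> count P d <= count P c <= (count P d).+1.
Proof.
move=> le_tr Pdown; elim: c d => [|x c IH] [|y d] // [szE].
rewrite interleave_cons /= => /andP[le_xy y_path].
have [Py|nPy] := boolP (P y).
  by rewrite (Pdown x y) // !add1n !ltnS IH // (path_sorted y_path).
have : count P (interleave c d) = 0.
  apply/eqP; rewrite -leqn0 leqNgt -has_count; apply/hasPn => z z_in.
  apply: contra nPy; apply: Pdown.
  exact: (allP (order_path_min le_tr y_path)).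
by rewrite count_interleave //; case: (P x); lia.
Qed.

Lemma count_le_head le t y d :
  transitive le -> path le y d -> ~~ le y t -> count (le^~ t) (y :: d) = 0.
Proof.
move=> le_tr y_path /negbTE nle /=; rewrite nle.
apply/eqP; rewrite -leqn0 leqNgt -has_count; apply/hasPn => z z_in.
apply/negP => le_zt; move/negP: nle; apply.
exact: le_tr (allP (order_path_min le_tr y_path) _ z_in) le_zt.
Qed.

Lemma count_interleave_sorted le c d :
    transitive le -> reflexive le -> size c = size d ->
    sorted le c -> sorted le d ->
    (forall t, count (le^~ t) d <= count (le^~ t) c <= (count (le^~ t) d).+1) ->
  sorted le (interleave c d).
Proof.
move=> le_tr le_refl; elim: c d => [|x c IH] [|y d] // [szE] xc yd cnt.
have le_xy : le x y.
  apply: contraT => nle; have := cnt y.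
  by rewrite (count_le_head le_tr xc nle) /= le_refl.
have le_yc z c' : c = z :: c' -> le y z.
  move=> cE; apply: contraT => nle; have := cnt z.
  rewrite (count_le_head le_tr yd nle) cE /= le_refl.
  by move: xc; rewrite cE /= => /andP[-> _]; lia.
have srt : sorted le (interleave c d).
  apply: IH => //; [exact: path_sorted xc|exact: path_sorted yd|move=> t].
  have [le_yt|nle] := boolP (le y t).
    by have := cnt t; rewrite /= le_yt (le_tr _ _ _ le_xy le_yt); lia.
  have := count_le_head le_tr yd nle; have := cnt t; rewrite /= (negbTE nle).
  have [le_xt|nle_x] := boolP (le x t); first by lia.
  by have := count_le_head le_tr xc nle_x; rewrite /= (negbTE nle_x); lia.
rewrite interleave_cons /= le_xy /=.
case: c d {IH cnt xc yd} szE le_yc srt => [|z c] [|w d] // _ le_yc.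
by rewrite interleave_cons /= (le_yc _ _ erefl).
Qed.

End Interleave.

(** * Cumulative counts *)

Section Cumulative.
Context (n : nat) (k : 'I_n -> nat).
Implicit Types (A B C D I : multi_index k).

Lemma pair_le_refl : reflexive (@pair_le n).
Proof. by case=> [[j i]|] //=; rewrite eqxx leqnn orbT. Qed.

Lemma pair_le_trans : transitive (@pair_le n).
Proof.
move=> [[j2 i2]|] [[j1 i1]|] [[j3 i3]|] //=.
move=> /orP[lt12|/andP[/eqP -> le12]] /orP[lt23|/andP[/eqP <- le23]].
- by rewrite (ltn_trans lt12).
- by rewrite lt12.
- by rewrite lt23.
- by rewrite eq_refl (leq_trans le12) ?orbT.
Qed.

Lemma pair_le_total : total (@pair_le n).
Proof.
move=> [[j1 i1]|] [[j2 i2]|] //=.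
have [//|lt21|/val_inj ->] := ltngtP (val j1) (val j2).
  by rewrite !orbT.
by rewrite eqxx leq_total.
Qed.

Lemma index_weightE I : index_weight I = \sum_(j < n) (I j != ord0).
Proof.
rewrite /index_weight -sum1dep_card big_mkcond /=.
by apply: eq_bigr => j _; case: ifP.
Qed.

Lemma index_weight_le I : index_weight I <= n.
Proof. by rewrite -[leqRHS]card_ord max_card. Qed.

Lemma count_Abar P I : count P (Abar I) =
  \sum_(j < n) ((I j != ord0) && P (Some (j, nat_of_ord (I j))))
    + P None * (n - index_weight I).
Proof.
rewrite count_cat count_nseq count_map count_filter; congr (_ + _).
rewrite -sum1_count big_mkcond big_enum /=; apply: eq_bigr => j _.
by rewrite andbC; case: (_ && _).
Qed.

Lemma size_Abar I : size (Abar I) = n.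
Proof.
rewrite -count_predT count_Abar mul1n.
under eq_bigr do rewrite andbT.
by rewrite -index_weightE subnKC ?index_weight_le.
Qed.

Definition cumul I (j : 'I_n) (i : nat) : nat :=
  count (fun y => pair_le y (Some (j, i))) (Abar I).

Definition support_below I (m : nat) : nat :=
  \sum_(j < n | j < m) (I j != ord0).

Lemma support_below0 I : support_below I 0 = 0.
Proof. by rewrite /support_below big_pred0. Qed.

Lemma support_belowS I (j : 'I_n) :
  support_below I j.+1 = support_below I j + (I j != ord0).
Proof.
rewrite /support_below (bigD1 j) //= addnC; congr (_ + _).
by apply: eq_bigl => j'; rewrite ltnS -val_eqE /=; lia.
Qed.

Lemma support_below_all I : support_below I n = index_weight I.
Proof.
rewrite index_weightE /support_below.
by apply: eq_bigl => j; rewrite ltn_ord.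
Qed.

Lemma cumulE I j i :
  cumul I j i = support_below I j + ((I j != ord0) && (I j <= i)).
Proof.
rewrite /cumul count_Abar mul0n addn0 /support_below [in RHS]big_mkcond /=.
rewrite (bigD1 j) //= [in RHS](bigD1 j) //= ltnn eqxx add0n addnC.
congr (_ + _); apply: eq_bigr => j' /negbTE ->.
by rewrite orbF; case: ifP => _; rewrite ?andbT ?andbF.
Qed.

Lemma eq_cumul I J :
  (forall j (i : 'I_(k j).+1), cumul I j i = cumul J j i) -> I = J.
Proof.
move=> eqIJ; apply/ffunP => j.
have eqB : support_below I j = support_below J j.
  by have := eqIJ j ord0; rewrite !cumulE !leqn0 !andNb !addn0.
have eqi (i : 'I_(k j).+1) :
    (I j != ord0) && (I j <= i) = (J j != ord0) && (J j <= i).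
  have := eqIJ j i; rewrite !cumulE eqB => /addnI.
  by case: (_ && _); case: (_ && _).
have [I0|I0] := eqVneq (I j) ord0; have [J0|J0] := eqVneq (J j) ord0.
- by rewrite I0 J0.
- by have := eqi (J j); rewrite I0 J0 leqnn eqxx.
- by have := eqi (I j); rewrite I0 J0 leqnn eqxx.
apply/val_inj/eqP; rewrite eqn_leq.
by have := eqi (J j); have := eqi (I j); rewrite I0 J0 !leqnn /= => <- ->.
Qed.

Definition threshold := {j : 'I_n & 'I_(k j).+1}.
HB.instance Definition _ := Finite.on threshold.

Definition cumul_at I (t : threshold) : nat := cumul I (tag t) (tagged t).

Definition near_geq C D :=
  [forall t : threshold, cumul_at D t <= cumul_at C t <= (cumul_at D t).+1].

Lemma near_geqP C D :
  reflect (forall j i, cumul D j i <= cumul C j i <= (cumul D j i).+1)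
          (near_geq C D).
Proof.
apply: (iffP forallP) => [near j i|near t]; last exact: near.
have cumul_min I : cumul I j i = cumul I j (inord (minn i (k j)) : 'I_(k j).+1).
  rewrite !cumulE inordK ?ltnS ?geq_minr // leq_min.
  by rewrite (_ : I j <= k j) ?andbT // -ltnS.
by rewrite !cumul_min; apply: (near (Tagged (fun j => 'I_(k j).+1) _)).
Qed.

Lemma sorted_pairE (C D : admissible_index k) :
  sorted_pair C D = near_geq (val C) (val D).
Proof.
pose s (I : multi_index k) := sort (@pair_le n) (Abar I).
have szE : size (s (val C)) = size (s (val D)) by rewrite !size_sort !size_Abar.
have cnt I P : count P (s I) = count P (Abar I).
  by apply/seq.permP; rewrite perm_sort.
apply/idP/near_geqP => [srt j i|near].
  rewrite /cumul -!cnt; apply: sorted_interleave_count srt => //.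
    exact: pair_le_trans.
  by move=> x y le_xy le_yt; apply: pair_le_trans le_yt.
apply: count_interleave_sorted => //.
- exact: pair_le_trans.
- exact: pair_le_refl.
- exact/sort_sorted/pair_le_total.
- exact/sort_sorted/pair_le_total.
case=> [[j i]|]; rewrite !cnt; first exact: near.
have all_le I : count (@pair_le n ^~ None) (Abar I) = n.
  by rewrite -[RHS](size_Abar I) -count_predT; apply: eq_count => -[[]|].
by rewrite !all_le leqnn leqnSn.
Qed.

(* At equal positions the nonzero entries of A and B are listed in increasing
   order, and the parity of the number of earlier entries tells which of C and
   D receives the next one. *)
Definition swapped A B (j : 'I_n) : bool :=
  odd (support_below A j + support_below B j)
    (+) ~~ ((B j == ord0) || (A j != ord0) && (A j <= B j)).

Definition sortl A B : multi_index k :=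
  [ffun j : 'I_n => if swapped A B j then B j else A j].
Definition sortr A B : multi_index k :=
  [ffun j : 'I_n => if swapped A B j then A j else B j].

Lemma support_below_sort A B m : m <= n ->
  support_below (sortl A B) m
    = uphalf (support_below A m + support_below B m) /\
  support_below (sortr A B) m
    = half (support_below A m + support_below B m).
Proof.
elim: m => [|m IH] lt_mn; first by rewrite !support_below0.
have [IHl IHr] := IH (ltnW lt_mn); pose j := Ordinal lt_mn.
rewrite !(support_belowS _ j) /= IHl IHr !ffunE /swapped.
rewrite !(fun_if (fun x => x != ord0)) -(negbK (B j == ord0)).
rewrite -[support_below A (Ordinal _)]/(support_below A m).
rewrite -[support_below B (Ordinal _)]/(support_below B m).
move: (support_below A m) (support_below B m) => a b.
by case: (A j != ord0); case: (B j != ord0); case: (_ <= _); case: ifP => /=;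
  lia.
Qed.

Lemma near_geq_sort A B : near_geq (sortl A B) (sortr A B).
Proof.
apply/near_geqP => j i; rewrite !cumulE !ffunE /swapped.
have [-> ->] := support_below_sort A B (ltnW (ltn_ord j)).
move: (support_below A j) (support_below B j) => a b.
have [->|A0] := eqVneq (A j) ord0; have [->|B0] := eqVneq (B j) ord0 => /=;
  case: ifP => //=; rewrite ?A0 ?B0 ?eqxx /=; lia.
Qed.

Lemma index_weight_sort A B : 2 <= index_weight A -> 2 <= index_weight B ->
  2 <= index_weight (sortl A B) /\ 2 <= index_weight (sortr A B).
Proof.
have [] := support_below_sort A B (leqnn n).
by rewrite !support_below_all => -> ->; lia.
Qed.

Lemma same_union_sort (A B C D : admissible_index k) :
    val C = sortl (val A) (val B) -> val D = sortr (val A) (val B) ->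
  same_union A B C D.
Proof.
move=> CE DE; suff cnt P : count P (Abar (val A) ++ Abar (val B))
           = count P (Abar (val C) ++ Abar (val D)) by apply/seq.permP.
rewrite (count_cat P (Abar (val A))) (count_cat P (Abar (val C))).
rewrite !count_Abar !index_weightE.
have sumE (f : forall j : 'I_n, 'I_(k j).+1 -> nat) :
    \sum_(j < n) f j (val A j) + \sum_(j < n) f j (val B j)
      = \sum_(j < n) f j (val C j) + \sum_(j < n) f j (val D j).
  rewrite -!big_split; apply: eq_bigr => j _; rewrite CE DE !ffunE /=.
  by case: ifP; rewrite // addnC.
have := sumE (fun j i => (i != ord0) && P (Some (j, nat_of_ord i))).
have := sumE (fun j i => i != ord0).
have le_n I : \sum_(j < n) (I j != ord0) <= n.
  by rewrite -index_weightE index_weight_le.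
move: (le_n (val A)) (le_n (val B)) (le_n (val C)) (le_n (val D)) => /=.
by case: (P None); lia.
Qed.

Lemma basis_quadruple_exists (A B : admissible_index k) :
    ~~ sorted_pair A B -> ~~ sorted_pair B A ->
  exists C D : admissible_index k, basis_quadruple A B C D.
Proof.
move=> nsAB nsBA.
have [wC wD] := index_weight_sort (valP A) (valP B).
pose adm I w : admissible_index k := exist (fun I => 2 <= index_weight I) I w.
exists (adm _ wC), (adm _ wD).
rewrite /basis_quadruple nsAB nsBA sorted_pairE.
by rewrite near_geq_sort same_union_sort.
Qed.

Lemma same_union_cumul A B C D j i :
    perm_eq (Abar A ++ Abar B) (Abar C ++ Abar D) ->
  cumul A j i + cumul B j i = cumul C j i + cumul D j i.
Proof. by move=> /seq.permP cnt; rewrite /cumul -!count_cat; apply: cnt. Qed.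

Lemma index_pointE I (t : {j : 'I_n & 'I_(k j).+1}) :
  index_point I t = (I (tag t) == tagged t)%:R%R.
Proof.
case: t => j i; rewrite /index_point sum_ffunE (bigD1 j) //= ffunE.
rewrite big1 => [|j' neq_j]; last first.
  rewrite ffunE; case: eqP => // /(congr1 tag) /= jE.
  by rewrite jE eqxx in neq_j.
by rewrite GRing.addr0 eq_Tagged /= eq_sym.
Qed.

Lemma count_Abar_entry I (j : 'I_n) (i : 'I_(k j).+1) : i != ord0 ->
  count (pred1 (Some (j, nat_of_ord i))) (Abar I) = (I j == i).
Proof.
move=> i0; rewrite count_Abar mul0n addn0 (bigD1 j) //= big1 => [|j' neq_j].
  rewrite addn0 (inj_eq Some_inj) xpair_eqE eqxx /= val_eqE.
  by have [->|_] := eqVneq (I j) i; rewrite ?i0 ?andbF.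
by rewrite (inj_eq Some_inj) xpair_eqE (negbTE neq_j) andbF.
Qed.

Lemma count_Abar_block I (j : 'I_n) :
  count (fun y => if y is Some (j', _) then j' == j else false) (Abar I)
    = (I j != ord0).
Proof.
rewrite count_Abar mul0n addn0 (bigD1 j) //= big1 => [|j' /negbTE ->].
  by rewrite addn0 eqxx andbT.
by rewrite andbF.
Qed.

Lemma same_union_index_point (A B C D : admissible_index k) :
    same_union A B C D ->
  (index_point (val A) + index_point (val B)
     = index_point (val C) + index_point (val D))%R.
Proof.
move=> /seq.permP cnt; apply/ffunP => -[j i]; rewrite !ffunE !index_pointE /=.
rewrite -!GRing.natrD; congr (_%:R)%R.
have cnt' P : count P (Abar (val A)) + count P (Abar (val B))
            = count P (Abar (val C)) + count P (Abar (val D)).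
  by rewrite -!count_cat; apply: cnt.
have [->|i0] := eqVneq i ord0.
  have := cnt' (fun y => if y is Some (j', _) then j' == j else false).
  rewrite !count_Abar_block.
  by case: eqP; case: eqP; case: eqP; case: eqP.
by have := cnt' (pred1 (Some (j, nat_of_ord i))); rewrite !count_Abar_entry.
Qed.

Definition sqdist (a b : nat) : nat := (a - b) ^ 2 + (b - a) ^ 2.

Lemma sqdistE a b : ((sqdist a b)%:Z = (a%:Z - b%:Z) * (a%:Z - b%:Z))%R.
Proof. by rewrite /sqdist; have [?|?] := leqP a b; nia. Qed.

(* With u = a - a' and so on, 2 (u^2 + v^2) = (u + v)^2 + (u - v)^2: the sum
   u + v is preserved by balancing and |u - v| drops to at most 1. *)
Lemma sqdist_balanced a a' b b' c c' d d' :
    a + b = c + d -> a' + b' = c' + d' ->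
    d <= c <= d.+1 -> d' <= c' <= d'.+1 ->
  sqdist c c' + sqdist d d' <= sqdist a a' + sqdist b b' ?= iff
    (a + b' <= (a' + b).+1) && (a' + b <= (a + b').+1).
Proof.
move=> sumE sumE' dc dc'; apply/leqifP.
have := sqdistE a a'; have := sqdistE b b'.
have := sqdistE c c'; have := sqdistE d d'.
have [u uE] : exists u, u = (a%:Z - a'%:Z)%R by eexists.
have [v vE] : exists v, v = (b%:Z - b'%:Z)%R by eexists.
have [w wE] : exists w, w = (c%:Z - c'%:Z)%R by eexists.
have [z zE] : exists z, z = (d%:Z - d'%:Z)%R by eexists.
rewrite -uE -vE -wE -zE => EZ EW EV EU.
case: ifP => near.
  have [] : (u = w /\ v = z) \/ (u = z /\ v = w) by lia.
    by case=> uw vz; rewrite uw in EU; rewrite vz in EV; apply/eqP; lia.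
  by case=> uw vz; rewrite uw in EU; rewrite vz in EV; apply/eqP; lia.
have h1 : (4 <= (u - v) * (u - v))%R by nia.
have h2 : ((w - z) * (w - z) <= 1)%R by nia.
have h3 : ((w + z) * (w + z) = (u + v) * (u + v))%R by congr (_ * _)%R; lia.
nia.
Qed.

Definition index_cost I : nat :=
  \sum_(p : threshold * threshold) sqdist (cumul_at I p.1) (cumul_at I p.2).

Lemma index_cost_sort (A B C D : admissible_index k) :
    basis_quadruple A B C D ->
  index_cost (val C) + index_cost (val D)
    < index_cost (val A) + index_cost (val B).
Proof.
case/and4P; rewrite !sorted_pairE => nAB nBA /forallP nCD same_ABCD.
have sumE t : cumul_at (val A) t + cumul_at (val B) t
            = cumul_at (val C) t + cumul_at (val D) t.
  exact: same_union_cumul.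
have balanced (p : threshold * threshold) :=
  sqdist_balanced (sumE p.1) (sumE p.2) (nCD p.1) (nCD p.2).
have [p far] : exists p : threshold * threshold,
    ~~ ((cumul_at (val A) p.1 + cumul_at (val B) p.2
           <= (cumul_at (val A) p.2 + cumul_at (val B) p.1).+1)
     && (cumul_at (val A) p.2 + cumul_at (val B) p.1
           <= (cumul_at (val A) p.1 + cumul_at (val B) p.2).+1)).
  have [t nt] : exists t,
      ~~ (cumul_at (val B) t <= cumul_at (val A) t <= (cumul_at (val B) t).+1).
    exact/forallPn.
  have [s ns] : exists s,
      ~~ (cumul_at (val A) s <= cumul_at (val B) s <= (cumul_at (val A) s).+1).
    exact/forallPn.
  pose j0 : 'I_n := Ordinal (leq_ltn_trans (leq0n _) (ltn_ord (tag t))).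
  pose zero : threshold := Tagged _ (ord0 : 'I_(k j0).+1).
  have x0 I : cumul_at I zero = 0.
    by rewrite /cumul_at cumulE /= support_below0 leqn0 andNb.
  have [far_t|near_t] := leqP (cumul_at (val B) t + 2) (cumul_at (val A) t).
    by exists (t, zero); cbn [fst snd]; rewrite !x0; lia.
  have [far_s|near_s] := leqP (cumul_at (val A) s + 2) (cumul_at (val B) s).
    by exists (s, zero); cbn [fst snd]; rewrite !x0; lia.
  by exists (s, t); cbn [fst snd]; lia.
rewrite /index_cost -!big_split /= (bigD1 p) //= [ltnRHS](bigD1 p) //=.
rewrite -addSn leq_add //; last by apply: leq_sum => q _; apply: balanced.
by rewrite (ltn_leqif (balanced p)).
Qed.
End Cumulative.

Local Open Scope ring_scope.
Import GRing.Theory.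

(* [monalg] clashes with [mpoly] and is therefore imported inside a module. *)
Module GroupAlgebraCoefficients.
Import monalg.

Lemma sum_chi_coef (R : comNzRingType) (M : zmodType) (I : Type) (s : seq I)
    (c : I -> R) (a : I -> M) (p : M) :
  \sum_(i <- s) c i *: chi R (a i) = 0 -> \sum_(i <- s | a i == p) c i = 0.
Proof.
move=> /(congr1 (fun g : {malg R[M]} => g@_p)).
rewrite mcoeff0 [X in X = _ -> _](raddf_sum (mcoeff p)) => sum0.
rewrite -[RHS]sum0 big_mkcond; apply: eq_bigr => i _.
rewrite [RHS](mcoeffZ (c i) << a i >>) mcoeffU.
by case: eqP; rewrite ?mulr1 ?mulr0.
Qed.

End GroupAlgebraCoefficients.
Export GroupAlgebraCoefficients.

From mathcomp Require Import mpoly.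

Section Ideals.
Context (F : fieldType) (N : nat).

Lemma ideal_generated_mono (S S' : {mpoly F[N]} -> Prop) f :
    (forall q, S q -> exists a p, S' p /\ q = a * p) ->
  ideal_generated S f -> ideal_generated S' f.
Proof.
move=> SS' [s sS ->]; elim: s sS => [|q s IH] sS.
  by exists [::]; rewrite ?big_nil.
have [s' s'S' eq_s'] : ideal_generated S' (\sum_(q <- s) q.1 * q.2).
  by apply: IH => p ps; apply: sS; rewrite inE ps orbT.
have [a [p [S'p qE]]] := SS' _ (sS q (mem_head _ _)).
exists ((q.1 * a, p) :: s') => [r|].
  by rewrite inE => /predU1P[->//|/s'S'].
by rewrite !big_cons eq_s' qE mulrA.
Qed.

End Ideals.

(** * Sorted monomials *)

Section Monomials.
Context (n : nat) (k : 'I_n -> nat).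
Local Notation N := (nvars k).
Implicit Types (m : 'X_{1..N}) (v w : 'I_N) (t : threshold k).
Local Open Scope nat_scope.

Definition index_of v : multi_index k := val (enum_val v : admissible_index k).

Lemma index_of_inj : injective index_of.
Proof. by move=> v w /val_inj/enum_val_inj. Qed.

Definition msum (x : 'I_N -> nat) m : nat := \sum_v m v * x v.

Lemma msumD x m1 m2 : msum x (m1 + m2)%MM = msum x m1 + msum x m2.
Proof.
rewrite /msum -big_split.
by apply: eq_bigr => v _; rewrite mnmDE mulnDl.
Qed.

Lemma msum0 x : msum x 0%MM = 0.
Proof. by rewrite /msum big1 // => v _; rewrite mnm0E. Qed.

Lemma msumU x v : msum x U_(v)%MM = x v.
Proof.
rewrite /msum (bigD1 v) //= mnm1E eqxx mul1n big1 ?addn0 // => w /negbTE neq.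
by rewrite mnm1E eq_sym neq.
Qed.

Definition mcost m := msum (fun v => index_cost (index_of v)) m.

Definition cost_le : rel 'X_{1..N} := fun m1 m2 =>
  (mcost m1 < mcost m2) || (mcost m1 == mcost m2) && (m1 <= m2)%O.

Lemma cost_le_term_order : term_order cost_le.
Proof.
rewrite /cost_le; split.
- by move=> m1 m2; case: ltngtP => //= _; apply: Order.TotalTheory.le_total.
- move=> m2 m1 m3 /=; case: (ltngtP (mcost m1)) => //= [lt12 _|->].
    by case: ltngtP => //= [lt23 _|<- _]; rewrite ?lt12 // (ltn_trans lt12).
  by case: ltngtP => //= _; apply: Order.POrderTheory.le_trans.
- by move=> m1 m2; case: ltngtP => //= _; apply: Order.POrderTheory.le_anti.
- by move=> m; rewrite {1 3}/mcost msum0 le0m andbT; case: (mcost m).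
- move=> m m1 m2; rewrite /mcost !msumD ltn_add2l eqn_add2l.
  by case/orP => [->//|/andP[-> le12]]; rewrite lemc_add2r le12 orbT.
Qed.

Definition mcount m t : nat := msum (fun v => index_of v (tag t) == tagged t) m.

Definition mcumul m t : nat := msum (fun v => cumul_at (index_of v) t) m.

Definition mpoint m : lattice k := (\sum_v index_point (index_of v) *+ m v)%R.

Lemma mpointE m t : (mpoint m t = (mcount m t)%:R)%R.
Proof.
rewrite /mpoint sum_ffunE /mcount /msum natr_sum; apply: eq_bigr => v _.
by rewrite ffunMnE index_pointE natrM mulr_natl.
Qed.

Lemma eq_mpointP m1 m2 :
  reflect (mcount m1 =1 mcount m2) (mpoint m1 == mpoint m2).
Proof.
apply: (iffP eqP) => [eq12 t|eq12].
  by apply/eqP; rewrite -eqz_nat -!natz -!mpointE eq12.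
by apply/ffunP => t; rewrite !mpointE eq12.
Qed.

Lemma mdeg_mcount m (j : 'I_n) :
  mdeg m = \sum_(i < (k j).+1) mcount m (Tagged (fun j => 'I_(k j).+1) i).
Proof.
rewrite mdegE exchange_big /=; apply: eq_bigr => v _.
rewrite -big_distrr /= (bigD1 (index_of v j)) //= eqxx big1 ?addn0 ?muln1 //.
by move=> i /negbTE neq; rewrite eq_sym neq.
Qed.

Lemma cumul_at_sum (I : multi_index k) t :
  cumul_at I t = \sum_(t' : threshold k | (tagged t' != ord0) &&
      pair_le (Some (tag t', nat_of_ord (tagged t')))
              (Some (tag t, nat_of_ord (tagged t))))
    (I (tag t') == tagged t').
Proof.
rewrite /cumul_at /cumul count_Abar mul0n addn0.
rewrite -(sig_big_dep xpredT (fun j (i : 'I_(k j).+1) => (i != ord0) &&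
      pair_le (Some (j, nat_of_ord i)) (Some (tag t, nat_of_ord (tagged t))))
      (fun j i => I j == i : nat)).
apply: eq_bigr => j _; rewrite big_mkcond (bigD1 (I j)) //= eqxx.
rewrite big1 ?addn0 => [|i /negbTE neq]; last first.
  by rewrite (eq_sym (I j)) neq if_same.
by case: ifP.
Qed.

Lemma mcumul_mcount m t :
  mcumul m t = \sum_(t' : threshold k | (tagged t' != ord0) &&
      pair_le (Some (tag t', nat_of_ord (tagged t')))
              (Some (tag t, nat_of_ord (tagged t)))) mcount m t'.
Proof.
rewrite exchange_big /=; apply: eq_bigr => v _.
by rewrite cumul_at_sum big_distrr.
Qed.

Definition pairwise_sorted m : bool :=
  [forall v, forall w, (0 < m v) && (0 < m w) ==>
    near_geq (index_of v) (index_of w) || near_geq (index_of w) (index_of v)].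

Lemma pairwise_sortedP m : reflect
    (forall v w, 0 < m v -> 0 < m w ->
       near_geq (index_of v) (index_of w) || near_geq (index_of w) (index_of v))
    (pairwise_sorted m).
Proof.
apply: (iffP 'forall_forallP) => [sm v w mv mw|sm v w].
  by have := sm v w; rewrite mv mw.
by apply/implyP => /andP[]; apply: sm.
Qed.

Lemma pairwise_sorted_max m : 0 < mdeg m -> pairwise_sorted m ->
  exists2 v, 0 < m v & forall w, 0 < m w -> near_geq (index_of v) (index_of w).
Proof.
rewrite lt0n mdeg_eq0 => m0 /pairwise_sortedP sm.
have [v0 mv0] : exists v, 0 < m v.
  apply/existsP; apply: contraR m0 => /existsPn m0; apply/eqP/mnmP => v.
  by rewrite mnm0E; apply/eqP; rewrite -leqn0 leqNgt m0.
pose size v := \sum_t cumul_at (index_of v) t.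
case: (@arg_maxnP _ v0 (fun v => 0 < m v) size mv0) => v mv maxv.
exists v => // w mw.
case/orP: (sm v w mv mw) => // /forallP nwv.
have eq_vw t : cumul_at (index_of v) t = cumul_at (index_of w) t.
  have leif_t (t' : threshold k) : true ->
      cumul_at (index_of v) t' <= cumul_at (index_of w) t'
        ?= iff (cumul_at (index_of v) t' == cumul_at (index_of w) t').
    by move=> _; apply/leqif_eq; case/andP: (nwv t').
  have := leqif_sum leif_t; case=> le_vw.
  rewrite eqn_leq le_vw (maxv w mw : size w <= size v) => /esym/forallP/(_ t).
  by move/eqP.
by apply/forallP => t; rewrite eq_vw leqnn leqnSn.
Qed.

Lemma mcumul_bounds m v t : 0 < m v ->
    (forall w, 0 < m w -> near_geq (index_of v) (index_of w)) ->
  mcumul m t <= mdeg m * cumul_at (index_of v) t < mcumul m t + mdeg m.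
Proof.
move=> mv near; rewrite mdegE /mcumul /msum big_distrl /=; apply/andP; split.
  apply: leq_sum => w _; case: (posnP (m w)) => [->//|/near/forallP/(_ t)].
  by case/andP=> le_wv _; rewrite leq_mul2l le_wv orbT.
rewrite -big_split /= (bigD1 v) //= [ltnRHS](bigD1 v) //= -addSn leq_add //.
  by rewrite -addn1 leq_add2l.
apply: leq_sum => w _; case: (posnP (m w)) => [->//|/near/forallP/(_ t)].
by case/andP=> _ le_vw; rewrite -mulnSr leq_mul2l le_vw orbT.
Qed.

Lemma pairwise_sorted_inj m1 m2 : 0 < n ->
    pairwise_sorted m1 -> pairwise_sorted m2 -> mcount m1 =1 mcount m2 ->
  m1 = m2.
Proof.
move=> n_gt0; have [d] := ubnP (mdeg m1); elim: d => // d IH in m1 m2 *.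
move=> deg_lt s1 s2 eq12.
have deg12 : mdeg m1 = mdeg m2.
  rewrite !(mdeg_mcount _ (Ordinal n_gt0)).
  by apply: eq_bigr => i _; apply: eq12.
have [deg0|deg1_gt0] := posnP (mdeg m1).
  have := deg0; rewrite deg12.
  by move: deg0 => /eqP + /eqP; rewrite !mdeg_eq0 => /eqP -> /eqP ->.
have deg2_gt0 := deg1_gt0; rewrite deg12 in deg2_gt0.
have [v1 m1v1 near1] := pairwise_sorted_max deg1_gt0 s1.
have [v2 m2v2 near2] := pairwise_sorted_max deg2_gt0 s2.
have v12 : v1 = v2.
  apply/index_of_inj/eq_cumul => j i.
  pose t : threshold k := Tagged (fun j => 'I_(k j).+1) i.
  rewrite -[LHS]/(cumul_at (index_of v1) t) -[RHS]/(cumul_at (index_of v2) t).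
  have := mcumul_bounds t m1v1 near1; have := mcumul_bounds t m2v2 near2.
  have -> : mcumul m2 t = mcumul m1 t.
    by rewrite !mcumul_mcount; apply: eq_bigr => t' _; rewrite eq12.
  by rewrite -deg12; nia.
rewrite -{}v12 {v2 near2} in m2v2; rewrite {near1}.
have le1 : (U_(v1) <= m1)%MM by rewrite lep1mP -lt0n.
have le2 : (U_(v1) <= m2)%MM by rewrite lep1mP -lt0n.
have sub_sorted m : pairwise_sorted m -> pairwise_sorted (m - U_(v1)).
  move=> /pairwise_sortedP sm; apply/pairwise_sortedP => v w mv mw.
  by apply: sm; [move: mv|move: mw]; rewrite mnmBE; lia.
rewrite -(submK le1) -(submK le2); congr (_ + _)%MM; apply: IH.
- by move: deg_lt; rewrite -{1}(submK le1) mdegD mdeg1; lia.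
- exact: sub_sorted.
- exact: sub_sorted.
move=> t; apply/eqP; rewrite -(eqn_add2r (mcount U_(v1)%MM t)).
rewrite -!msumD !submK //.
exact/eqP/eq12.
Qed.

Lemma index_of_rank (A : admissible_index k) : index_of (enum_rank A) = val A.
Proof. by rewrite /index_of enum_rankK. Qed.

Lemma msum_zmon2 x (A B : admissible_index k) :
  msum x (zmon A + zmon B)%MM = x (enum_rank A) + x (enum_rank B).
Proof. by rewrite msumD !msumU. Qed.

Lemma basis_quadruple_mcount (A B C D : admissible_index k) :
    basis_quadruple A B C D ->
  mcount (zmon A + zmon B)%MM =1 mcount (zmon C + zmon D)%MM.
Proof.
case/and4P => _ _ _ /same_union_index_point eqp t.
have := congr1 (fun p : lattice k => p t) eqp.
rewrite 2!ffunE !index_pointE -!natrD !natz => -[].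
by rewrite /mcount !msum_zmon2 !index_of_rank.
Qed.

Lemma basis_quadruple_mcost (A B C D : admissible_index k) :
    basis_quadruple A B C D ->
  mcost (zmon C + zmon D)%MM < mcost (zmon A + zmon B)%MM.
Proof. by move/index_cost_sort; rewrite /mcost !msum_zmon2 !index_of_rank. Qed.

Lemma not_pairwise_sorted m : ~~ pairwise_sorted m ->
  exists A B C D : admissible_index k,
    basis_quadruple A B C D /\ (zmon A + zmon B <= m)%MM.
Proof.
case/forallPn=> v /forallPn[w]; rewrite negb_imply negb_or.
case/andP=> /andP[mv mw] /andP[nvw nwv].
have neq_vw : v != w.
  by apply: contraNneq nvw => ->; apply/forallP => t; rewrite leqnn leqnSn.
have [C [D bABCD]] : exists C D, basis_quadruple (enum_val v) (enum_val w) C D.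
  by apply: basis_quadruple_exists; rewrite sorted_pairE.
exists (enum_val v), (enum_val w), C, D; split=> //.
apply/mnm_lepP => u; rewrite mnmDE !mnm1E !enum_valK.
have [<-|_] := eqVneq v u; first by rewrite eq_sym (negbTE neq_vw).
by have [<-|] := eqVneq w u.
Qed.

Lemma sort_monomial m : exists m',
  [/\ pairwise_sorted m', mcount m' =1 mcount m & m' = m \/ mcost m' < mcost m].
Proof.
have [d] := ubnP (mcost m); elim: d => // d IH in m *; move=> lt_md.
have [sm|] := boolP (pairwise_sorted m); first by exists m; split=> //; left.
move=> /not_pairwise_sorted[A [B [C [D [bABCD /submK]]]]].
set m0 := (m - _)%MM => mE.
have cost_lt : mcost (m0 + (zmon C + zmon D))%MM < mcost m.
  by rewrite -{1}mE /mcost !(msumD _ m0) ltn_add2l basis_quadruple_mcost.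
have [|m' [sm' eq_m' cost_m']] := IH (m0 + (zmon C + zmon D))%MM.
  exact: leq_trans cost_lt _.
exists m'; split=> // [t|].
  rewrite eq_m' -mE [LHS](msumD _ m0) [RHS](msumD _ m0); congr (_ + _).
  exact/esym/basis_quadruple_mcount.
by right; case: cost_m' => [->//|/ltn_trans]; apply.
Qed.

End Monomials.

(** * The Groebner basis *)

Section Groebner.
Context (F : fieldType) (n : nat) (k : 'I_n -> nat).
Local Notation N := (nvars k).
Implicit Types (f g : {mpoly F[N]}) (m : 'X_{1..N}).
Implicit Types (A B C D : admissible_index k).

Lemma mmap1_chi m :
  mmap1 (fun v : 'I_N => chi F (index_point (val (enum_val v)))) m
    = chi F (mpoint m).
Proof.
rewrite /mmap1 /mpoint (big_morph (@chi F (lattice k)) (@chiD _ _) (@chi0 _ _)).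
apply: eq_bigr => v _; elim: (m v) => [|i IH].
  by rewrite mulr0n expr0 chi0.
by rewrite exprS mulrS chiD IH.
Qed.

Lemma toric_mapE f :
  toric_map k F f = \sum_(m <- msupp f) f@_m *: chi F (mpoint m).
Proof.
rewrite /toric_map /mmap; apply: eq_bigr => m _.
by rewrite mmap1_chi -scalerAl mul1r.
Qed.

Lemma toric_ideal_same_fibre f m : toric_ideal k F f -> m \in msupp f ->
  exists2 m', m' \in msupp f & m' != m /\ mpoint m' = mpoint m.
Proof.
rewrite /toric_ideal toric_mapE.
move=> /(@sum_chi_coef _ _ _ _ _ _ (mpoint m)) sum0 fm.
have [/hasP[m' fm' /andP[neq /eqP eqp]]|/hasPn no_other] :=
  boolP (has (fun m' => (m' != m) && (mpoint m' == mpoint m)) (msupp f)).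
  by exists m'.
move: sum0; rewrite big_mkcond (bigD1_seq m) //= eqxx.
rewrite big_seq_cond big1 => [|m'].
  by rewrite addr0 => fm0; move: fm; rewrite mcoeff_msupp fm0 eqxx.
by case/andP => /no_other + neq; rewrite neq /= => /negbTE ->.
Qed.

Lemma sorting_binomialE A B C D : sorting_binomial F A B C D
  = 'X_[zmon A + zmon B] - 'X_[zmon C + zmon D].
Proof. by rewrite /sorting_binomial /zvar !mpolyXD. Qed.

Lemma sorting_binomial_toric A B C D : basis_quadruple A B C D ->
  toric_ideal k F (sorting_binomial F A B C D).
Proof.
move=> /basis_quadruple_mcount/eq_mpointP/eqP eqp.
rewrite /toric_ideal sorting_binomialE /toric_map mmapB !mmapX !mmap1_chi.
by rewrite eqp subrr.
Qed.

Lemma sorting_binomial_lead A B C D : basis_quadruple A B C D ->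
  leading_monomial (@cost_le n k) (sorting_binomial F A B C D)
    (zmon A + zmon B)%MM.
Proof.
move=> /basis_quadruple_mcost cost_lt; rewrite sorting_binomialE; split.
  rewrite mcoeff_msupp mcoeffB !mcoeffX eqxx.
  have [eqm|_] := eqVneq (zmon C + zmon D)%MM (zmon A + zmon B)%MM.
    by rewrite eqm ltnn in cost_lt.
  by rewrite subr0 oner_eq0.
move=> m /msuppB_le; rewrite mem_cat !msuppX !inE => /orP[]/eqP->.
  by rewrite /cost_le eqxx Order.POrderTheory.lexx orbT.
by rewrite /cost_le cost_lt.
Qed.

Lemma toric_lead_not_sorted f m : (0 < n)%N -> toric_ideal k F f ->
  leading_monomial (@cost_le n k) f m -> ~~ pairwise_sorted m.
Proof.
move=> n_gt0 If [fm lead_m]; apply/negP => sm.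
have [m1 fm1 [neq eqp]] := toric_ideal_same_fibre If fm.
have [m' [sm' eq_m' m'E]] := sort_monomial m1.
have m'm : m' = m.
  apply: pairwise_sorted_inj => // t; rewrite eq_m'.
  by apply/eq_mpointP; apply/eqP.
case: m'E => [eq_m1|cost_lt]; first by rewrite -eq_m1 m'm eqxx in neq.
have := lead_m _ fm1; rewrite -m'm /cost_le ltnNge ltnW //=.
by case: ltngtP cost_lt.
Qed.

Lemma basis_binomialsP g : g \in basis_binomials k F ->
  exists A B C D, basis_quadruple A B C D /\ g = sorting_binomial F A B C D.
Proof.
case/mapP => [[[A B] [C D]]]; rewrite mem_filter => /andP[bABCD _] ->.
by exists A, B, C, D.
Qed.

Lemma groebner_basis_binomials : (0 < n)%N ->
  groebner_basis (@cost_le n k) (toric_ideal k F) (basis_binomials k F).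
Proof.
move=> n_gt0.
have Ibasis g : g \in basis_binomials k F -> toric_ideal k F g.
  case/basis_binomialsP => A [B [C [D [bABCD ->]]]].
  exact: sorting_binomial_toric.
split=> // f; split.
  apply: ideal_generated_mono => q [g [m [Sg lead_g ->]]].
  have [A [B [C [D [bABCD le_m]]]]] :=
      not_pairwise_sorted (toric_lead_not_sorted n_gt0 Sg lead_g).
  exists 'X_[m - (zmon A + zmon B)], 'X_[zmon A + zmon B].
  rewrite -mpolyXD submK //; split=> //.
  exists (sorting_binomial F A B C D), (zmon A + zmon B)%MM.
  split=> //; last exact: sorting_binomial_lead.
  by apply/mapP; exists ((A, B), (C, D)); rewrite // mem_filter bABCD mem_enum.
apply: ideal_generated_mono => q [g [m [Sg lead_g ->]]].
exists 1, 'X_[m]; rewrite mul1r; split=> //.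
by exists g, m; split=> //; apply: Ibasis.
Qed.

Lemma basis_binomial_homog g : g \in basis_binomials k F -> g \is 2.-homog.
Proof.
case/basis_binomialsP => A [B [C [D [_ ->]]]].
by rewrite sorting_binomialE rpredB ?dhomogX //= mdegD !mdeg1.
Qed.

Lemma basis_binomial_squarefree g m : g \in basis_binomials k F ->
  leading_monomial (@cost_le n k) g m -> squarefree_monomial m.
Proof.
case/basis_binomialsP => A [B [C [D [bABCD ->]]]] [gm lead_m].
have [gAB lead_AB] := sorting_binomial_lead bABCD.
have -> : m = (zmon A + zmon B)%MM.
  by apply: (term_order_anti (cost_le_term_order k)); rewrite lead_AB ?lead_m.
have neq_AB : A != B.
  case/and4P: bABCD => nsAB _ _ _; apply: contraNneq nsAB => ->.
  by rewrite sorted_pairE; apply/forallP => t; rewrite leqnn leqnSn.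
move=> u; rewrite mnmDE !mnm1E.
have [<-|_] := eqVneq (enum_rank A) u; last by case: eqP.
by rewrite (inj_eq enum_rank_inj) eq_sym (negbTE neq_AB).
Qed.

End Groebner.

Theorem theorem7p9 (R : realType) (n : nat) (k : 'I_n -> nat)
    (hn : (2 <= n)%N) (hk : forall j : 'I_n, (1 <= k j)%N) :
  exists le : rel 'X_{1..nvars k},
    [/\ term_order le,
        groebner_basis le (toric_ideal k R[i]%C) (basis_binomials k R[i]%C),
        (forall A B C D : admissible_index k, basis_quadruple A B C D ->
           leading_monomial le (sorting_binomial R[i]%C A B C D)
             (zmon A + zmon B)%MM)
      & (forall g : {mpoly R[i]%C[nvars k]}, g \in basis_binomials k R[i]%C ->
           g \is 2.-homog /\
           (forall m, leading_monomial le g m -> squarefree_monomial m))].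
Proof.
exists (@cost_le n k); split.
- exact: cost_le_term_order.
- exact/groebner_basis_binomials/ltnW.
- by move=> A B C D; apply: sorting_binomial_lead.
move=> g g_basis; split; first exact: basis_binomial_homog.
by move=> m; apply: basis_binomial_squarefree.
Qed.
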